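(* If Conjecture L holds, then for any $\varepsilon>0$ there is no polynomial-time algorithm certifying that $\widehat{\alpha}(G)\le \frac{2}{\sqrt d}(1-\varepsilon+o(1))$ with high probability when $G\sim\mathcal{G}(n,d)$. Here $o(1)$ refers to the limit $d\to\infty$.
   Context: $\widehat\alpha(G)=\alpha(G)/|V(G)|$, where $\alpha$ is the independence number. ''With high probability'' means with probability tending to $1$ as $n\to\infty$. Models: $\mathcal{G}(n,d)$ is the uniform distribution on simple $d$-regular graphs on $[n]$; $\mathcal{G}((\frac n2,\frac n2),d)$ is the uniform distribution on simple $d$-regular bipartite graphs with both sides of size $n/2$. For a $d$-regular multigraph $H$ on $k$ vertices (loops allowed, each loop contributing $1$ to the degree; adjacency matrix $M$ with $M_{ii}$ the number of loops at $i$), the random lift $\mathcal{L}_m(H)$ is the law of the graph on $km$ vertices split into fibers of size $m$ indexed by $V(H)$. For each non-loop edge $\{i,j\}$ of $H$, an independent uniformly random perfect matching between fibers $i$ and $j$ is inserted. For each loop at $i$, an independent uniformly random perfect matching within fiber $i$ is inserted ($m$ even when loops are present). The output is conditioned on being simple. Ramanujan conditions: $H$ is Ramanujan if $\max\{|\lambda_2(H)|,|\lambda_k(H)|\}\le 2\sqrt{d-1}$. It is bipartite Ramanujan if it is bipartite and $\max\{|\lambda_2(H)|,|\lambda_{k-1}(H)|\}\le 2\sqrt{d-1}$. Here $\lambda_1\ge\dots$ are adjacency eigenvalues. Noise: for $d$-regular $G,G'$ on the same $n$ vertices, $\Delta(G,G')=|E(G)\triangle E(G')|/(2n)$. For $\epsilon\in(0,1)$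 the noise models are: - $\mathcal{S}^{\mathrm{rand}}_\epsilon$ deletes $\lfloor\epsilon n\rfloor$ uniformly random edges, then adds $\lfloor\epsilon n\rfloor$ uniformly random edges conditioned on the result being $d$-regular. - $\mathcal{S}^{\mathrm{rand,bi}}_\epsilon$ is the same, except the added edges go across the bipartition. - The respectful versions $\widetilde{\mathcal{S}}^{\mathrm{rand}}_\epsilon,\widetilde{\mathcal{S}}^{\mathrm{rand,bi}}_\epsilon$, applied to $G\sim\mathcal{L}_m(H)$, additionally condition on no added edge joining the fibers of $i,j$ with $M_{ij}=0$. - Adversarial noise $\mathcal{S}^{\mathrm{adv}}_\epsilon\mathcal{L}_m(H)$ is any distribution obtained by sampling $G\sim\mathcal{L}_m(H)$ and letting an adversary (with extra randomness) output a $d$-regular $G'$ with $\Delta(G,G')\le\epsilon$. The respectful adversarial version $\widetilde{\mathcal{S}}^{\mathrm{adv}}_\epsilon$ additionally forbids adding edges between fibers of $i,j$ with $M_{ij}=0$. - ''Hard under adversarial noise'' means some choice of adversary makes it hard. An algorithm achieves strong detection between $\mathbb{P}_n$ and $\mathbb{Q}_n$ if both of its error probabilities tend to $0$. Conjecture L: for every $d$-regular Ramanujan multigraph $H$ on $k$ vertices and every $\epsilon>0$, no polynomial-time algorithm achieves strong detection between $\mathcal{S}_\epsilon\mathcal{L}_m(H)$ and $\mathcal{G}(km,d)$ as $m\to\infty$, for each $\mathcal{S}_\epsilon\in\{\mathcal{S}^{\mathrm{rand}}_\epsilon,\widetilde{\mathcal{S}}^{\mathrm{rand}}_\epsilon,\mathcal{S}^{\mathrm{adv}}_\epsilon,\widetilde{\mathcal{S}}^{\mathrm{adv}}_\epsilon\}$.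 Likewise, for every $d$-regular bipartite Ramanujan $H$ and $\epsilon>0$, none exists between $\mathcal{S}_\epsilon\mathcal{L}_m(H)$ and $\mathcal{G}((\frac{km}2,\frac{km}2),d)$, for each $\mathcal{S}_\epsilon\in\{\mathcal{S}^{\mathrm{rand,bi}}_\epsilon,\widetilde{\mathcal{S}}^{\mathrm{rand,bi}}_\epsilon,\mathcal{S}^{\mathrm{adv}}_\epsilon,\widetilde{\mathcal{S}}^{\mathrm{adv}}_\epsilon\}$. Certification: an algorithm with output $c(G)$ certifies an upper bound on $f$ if $f(G)\le c(G)$ for every input $d$-regular $G$. It certifies $f(G)\le B$ with high probability if moreover $\Pr[c(G)\le B]\to1$ as $n\to\infty$. *)

(* Defs.v *)
From HB Require Import structures.
From mathcomp Require Import all_boot all_order all_algebra.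
From mathcomp Require Import all_classical all_reals all_analysis.

Set Implicit Arguments.
Unset Strict Implicit.
Unset Printing Implicit Defensive.

Import Order.TTheory GRing.Theory Num.Theory.
Import numFieldNormedType.Exports.
Local Open Scope ring_scope.

(** * Polynomial time

    Deterministic one-tape Turing machines over the tape alphabet
    {0, 1, blank}, blank being [None].  A machine halts when [tm_trans] is
    undefined; its output is the word that starts at the head and extends to
    the right up to the first blank. *)

Inductive direction := MoveLeft | Stay | MoveRight.

Record turing_machine := TuringMachine {
  tm_state : finType;
  tm_start : tm_state;
  tm_trans : tm_state -> option bool ->
             option (tm_state * option bool * direction) }.

(* [tleft] is listed from the head outwards; all unlisted cells are blank. *)
Record tape := Tape {
  tleft : seq (option bool);
  thead : option bool;
  tright : seq (option bool) }.

Definition move_tape (a : direction) (t : tape) : tape :=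
  let: Tape l h r := t in
  match a with
  | MoveLeft => Tape (behead l) (head None l) (h :: r)
  | Stay => t
  | MoveRight => Tape (h :: l) (head None r) (behead r)
  end.

Definition tm_step (T : turing_machine) (c : tm_state T * tape) :
    option (tm_state T * tape) :=
  if tm_trans c.1 (thead c.2) is Some (q, b, a)
  then Some (q, move_tape a (Tape (tleft c.2) b (tright c.2))) else None.

(* The final tape, if the machine halts after at most [n] steps. *)
Fixpoint tm_run (T : turing_machine) (n : nat) (c : tm_state T * tape) :
    option tape :=
  if tm_step c is Some c' then
    if n is n'.+1 then tm_run n' c' else None
  else Some c.2.

Definition input_tape (w : seq bool) : tape :=
  let s := map Some w in Tape [::] (head None s) (behead s).

Fixpoint leading_word (s : seq (option bool)) : seq bool :=
  if s is Some b :: s' then b :: leading_word s' else [::].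

Definition tape_output (t : tape) : seq bool :=
  leading_word (thead t :: tright t).

Definition polytime (f : seq bool -> seq bool) : Prop :=
  exists (T : turing_machine) (p : {poly nat}), forall w : seq bool,
    omap tape_output (tm_run p.[size w] (tm_start T, input_tape w))
    = Some (f w).

(* The word p_0 q_0 p_1 q_1 ... stands for the pair of the natural numbers
   whose binary digits, least significant first, are the p_i and the q_i. *)
Fixpoint nat_pair_of_word (w : seq bool) : nat * nat :=
  if w is [:: a, b & w'] then
    let: (p, q) := nat_pair_of_word w' in ((a + p.*2)%N, (b + q.*2)%N)
  else (0%N, 0%N).

(** * Simple graphs on {0, ..., n-1}, as edge sets *)

Notation edge_set n := {set {set 'I_n}}.

Definition regular_graph (n d : nat) (E : edge_set n) : bool :=
  [forall e in E, #|e| == 2%N] && [forall v, #|[set e in E | v \in e]| == d].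

Definition balanced_bipartite (n : nat) (E : edge_set n) : bool :=
  [exists S : {set 'I_n},
    (#|S|.*2 == n) && [forall e in E, #|e :&: S| == 1%N]].

Definition independent (n : nat) (E : edge_set n) (S : {set 'I_n}) : bool :=
  [forall e in E, ~~ (e \subset S)].

Definition independence_number (n : nat) (E : edge_set n) : nat :=
  \max_(S : {set 'I_n} | independent E S) #|S|.

(* The adjacency matrix, row by row. *)
Definition encode_graph (n : nat) (E : edge_set n) : seq bool :=
  [seq [set x; y] \in E | x <- enum 'I_n, y <- enum 'I_n].

(** * Base multigraphs, given by their adjacency matrix *)

Definition regular_multigraph (k d : nat) (M : 'M[nat]_k) : Prop :=
  M^T = M /\ forall i, (\sum_j M i j)%N = d.

Definition has_loop (k : nat) (M : 'M[nat]_k) : bool :=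
  [exists i, M i i != 0%N].

Definition bipartition (k : nat) (M : 'M[nat]_k) (side : 'I_k -> bool) : Prop :=
  forall i j, M i j != 0%N -> side i != side j.

(* One element per edge of the multigraph: [M i j] of them for i <= j. *)
Definition multigraph_edge (k : nat) (M : 'M[nat]_k) : finType :=
  {e : {ij : 'I_k * 'I_k & 'I_(M ij.1 ij.2)}
     | ((tag e).1 <= (tag e).2)%N}.

Definition edge_fst (k : nat) (M : 'M[nat]_k) (e : multigraph_edge M) : 'I_k :=
  (tag (val e)).1.

Definition edge_snd (k : nat) (M : 'M[nat]_k) (e : multigraph_edge M) : 'I_k :=
  (tag (val e)).2.

(** * Random lifts *)

(* [fib v] is the index of the fiber of the vertex v. *)
Definition perfect_matching (k n : nat) (fib : {ffun 'I_n -> 'I_k})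
    (i j : 'I_k) (F : edge_set n) : bool :=
  [forall e in F, exists x, exists y,
     [&& e == [set x; y], x != y, fib x == i & fib y == j]]
  && [forall v, (fib v \in [:: i; j]) ==> (#|[set e in F | v \in e]| == 1%N)].

(* The fibers, and one matching for each edge of the multigraph. *)
Notation lift_sample k M m :=
  ({ffun 'I_(k * m) -> 'I_k} * {ffun @multigraph_edge k M -> edge_set (k * m)})%type.

(* The fibers form an arbitrary ordered partition of the vertices into k sets
   of size m.  As the number of matchings available to an edge does not depend
   on that partition, the uniform law on [lift_space M m] is that of a uniform
   partition and independent uniform perfect matchings, conditioned on the
   matchings being pairwise disjoint, i.e. on their union being simple. *)
Definition lift_space (k : nat) (M : 'M[nat]_k) (m : nat) :
    {set lift_sample k M m} :=
  [set s : lift_sample k M m |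
    [&& [forall i, #|[set v | s.1 v == i]| == m],
        [forall e, perfect_matching s.1 (edge_fst e) (edge_snd e) (s.2 e)]
      & [forall e, forall e', (e != e') ==> [disjoint s.2 e & s.2 e']]]].

Definition lift_graph (k : nat) (M : 'M[nat]_k) (m : nat)
    (s : lift_sample k M m) : edge_set (k * m) :=
  \bigcup_e s.2 e.

Definition respects (k n : nat) (M : 'M[nat]_k) (fib : {ffun 'I_n -> 'I_k})
    (e : {set 'I_n}) : bool :=
  [forall x in e, forall y in e, (x != y) ==> (M (fib x) (fib y) != 0%N)].

Definition crosses (k n : nat) (side : 'I_k -> bool)
    (fib : {ffun 'I_n -> 'I_k}) (e : {set 'I_n}) : bool :=
  [forall x in e, forall y in e, (x != y) ==> (side (fib x) != side (fib y))].

Section Laws.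
Variable R : realType.

(** * Finite probability: a law on T is its mass function T -> R *)

Definition uniform_law (T : finType) (S : {set T}) (x : T) : R :=
  (x \in S)%:R / #|S|%:R.

Definition prob (T : finType) (P : T -> R) (A : pred T) : R :=
  \sum_(x | A x) P x.

Definition mixture (T U : finType) (P : T -> R) (K : T -> U -> R) (y : U) : R :=
  \sum_x P x * K x y.

Definition random_regular (n d : nat) : edge_set n -> R :=
  uniform_law [set E | regular_graph d E].

Definition random_bipartite_regular (n d : nat) : edge_set n -> R :=
  uniform_law [set E | regular_graph d E && balanced_bipartite E].

(** * Spectrum *)

(* s lists the eigenvalues of M with multiplicity, in nonincreasing order. *)
Definition ordered_spectrum (k : nat) (M : 'M[nat]_k) (s : seq R) : Prop :=
  sorted (fun x y => y <= x) s /\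
  char_poly (map_mx (fun a : nat => a%:R : R) M) = \prod_(x <- s) ('X - x%:P).

(* Lists are indexed from 0: lambda_j is [s`_j.-1]. *)
Definition ramanujan (k d : nat) (M : 'M[nat]_k) : Prop :=
  exists2 s, ordered_spectrum M s &
    Num.max `|s`_1| `|s`_k.-1| <= 2 * Num.sqrt (d%:R - 1).

Definition bipartite_ramanujan (k d : nat) (M : 'M[nat]_k) : Prop :=
  (exists side, bipartition M side) /\
  exists2 s, ordered_spectrum M s &
    Num.max `|s`_1| `|s`_k.-2| <= 2 * Num.sqrt (d%:R - 1).

(** * Noise *)

Definition graph_dist (n : nat) (E E' : edge_set n) : R :=
  #|(E :\: E') :|: (E' :\: E)|%:R / (2 * n%:R).

(* [ok] is the constraint on the added edges. *)
Definition additions (n d : nat) (ok : pred {set 'I_n}) (a : nat)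
    (E : edge_set n) : {set edge_set n} :=
  [set A : edge_set n | [&& #|A| == a, [disjoint A & E],
     regular_graph d (E :|: A) & [forall e in A, ok e]]].

Definition rand_noise (n d : nat) (ok : pred {set 'I_n}) (eps : R)
    (E : edge_set n) : edge_set n -> R :=
  let a := Num.truncn (eps * n%:R) in
  mixture (uniform_law [set D : edge_set n | (D \subset E) && (#|D| == a)])
    (fun D => mixture (uniform_law (additions d ok a (E :\: D)))
      (fun A => uniform_law [set (E :\: D) :|: A])).

(* A noise sends a graph and its fibers to a law on graphs. *)
Definition noise (k : nat) : Type :=
  forall m : nat, {ffun 'I_(k * m) -> 'I_k} -> edge_set (k * m) ->
    edge_set (k * m) -> R.

Definition S_rand (k d : nat) (eps : R) : noise k :=
  fun m fib => rand_noise d predT eps.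

Definition S_rand_resp (k d : nat) (M : 'M[nat]_k) (eps : R) : noise k :=
  fun m fib => rand_noise d (respects M fib) eps.

Definition S_rand_bi (k d : nat) (side : 'I_k -> bool) (eps : R) : noise k :=
  fun m fib => rand_noise d (crosses side fib) eps.

Definition S_rand_bi_resp (k d : nat) (M : 'M[nat]_k) (side : 'I_k -> bool)
    (eps : R) : noise k :=
  fun m fib => rand_noise d
    (fun e => crosses side fib e && respects M fib e) eps.

Definition adversary (k d : nat) (M : 'M[nat]_k) (eps : R) (K : noise k) :
    Prop :=
  forall m (s : lift_sample k M m), s \in lift_space M m ->
    [/\ forall E', 0 <= K m s.1 (lift_graph s) E',
        \sum_E' K m s.1 (lift_graph s) E' = 1
      & forall E', K m s.1 (lift_graph s) E' != 0 ->
          regular_graph d E' /\ graph_dist (lift_graph s) E' <= eps].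

Definition resp_adversary (k d : nat) (M : 'M[nat]_k) (eps : R) (K : noise k) :
    Prop :=
  adversary d M eps K /\
  forall m (s : lift_sample k M m), s \in lift_space M m ->
    forall E', K m s.1 (lift_graph s) E' != 0 ->
      forall e, e \in E' :\: lift_graph s -> respects M s.1 e.

Definition noisy_lift (k : nat) (M : 'M[nat]_k) (K : noise k) (m : nat) :
    edge_set (k * m) -> R :=
  mixture (uniform_law (lift_space M m)) (fun s => K m s.1 (lift_graph s)).

(** * Detection and certification *)

(* m -> oo, along even m if the base multigraph has loops. *)
Definition lift_sizes (k : nat) (M : 'M[nat]_k) : set_system nat :=
  within (fun m => has_loop M ==> ~~ odd m)%classic (\oo)%classic.

(* n -> oo, along the n for which n * d is even. *)
Definition regular_sizes (d : nat) : set_system nat :=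
  within (fun n => ~~ odd (n * d))%classic (\oo)%classic.

(* The answer [true] is a guess for P. *)
Definition strong_detection (N : nat -> nat) (F : set_system nat)
    (P Q : forall m, edge_set (N m) -> R) (test : pred (seq bool)) : Prop :=
  (prob (@P m) (fun E => ~~ test (encode_graph E)) @[m --> F] --> (0 : R))%classic
  /\
  (prob (@Q m) (fun E => test (encode_graph E)) @[m --> F] --> (0 : R))%classic.

Definition hard_to_detect (N : nat -> nat) (F : set_system nat)
    (P Q : forall m, edge_set (N m) -> R) : Prop :=
  ~ exists test : pred (seq bool),
      polytime (fun w => [:: test w]) /\ strong_detection F P Q test.

Definition hard_lift (k d : nat) (M : 'M[nat]_k) (K : noise k) : Prop :=
  hard_to_detect (N := fun m => (k * m)%N) (lift_sizes M)
    (noisy_lift M K) (fun m => @random_regular (k * m) d).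

Definition hard_bipartite_lift (k d : nat) (M : 'M[nat]_k) (K : noise k) :
    Prop :=
  hard_to_detect (N := fun m => (k * m)%N) (lift_sizes M)
    (noisy_lift M K) (fun m => @random_bipartite_regular (k * m) d).

Definition conjecture_L : Prop :=
  forall (d k : nat) (M : 'M[nat]_k) (eps : R),
    (3 <= d)%N -> regular_multigraph d M -> 0 < eps < 1 ->
    (ramanujan d M ->
       [/\ hard_lift d M (S_rand d eps),
           hard_lift d M (S_rand_resp d M eps),
           exists2 K, adversary d M eps K & hard_lift d M K
         & exists2 K, resp_adversary d M eps K & hard_lift d M K])
    /\
    (bipartite_ramanujan d M -> forall side, bipartition M side ->
       [/\ hard_bipartite_lift d M (S_rand_bi d side eps),
           hard_bipartite_lift d M (S_rand_bi_resp d M side eps),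
           exists2 K, adversary d M eps K & hard_bipartite_lift d M K
         & exists2 K, resp_adversary d M eps K & hard_bipartite_lift d M K]).

Definition alpha_hat (n : nat) (E : edge_set n) : R :=
  (independence_number E)%:R / n%:R.

(* A fraction with denominator 0 has value 0, which bounds no [alpha_hat E]
   from above when n > 0. *)
Definition certified_value (c : seq bool -> seq bool) (n : nat)
    (E : edge_set n) : R :=
  let: (p, q) := nat_pair_of_word (c (encode_graph E)) in p%:R / q%:R.

Definition certifies_whp (d : nat) (f : forall n, edge_set n -> R) (B : R)
    (c : seq bool -> seq bool) : Prop :=
  (forall n (E : edge_set n), regular_graph d E ->
     f n E <= certified_value c E)
  /\
  (prob (@random_regular n d) (fun E => certified_value c E <= B)
     @[n --> regular_sizes d] --> (1 : R))%classic.

End Laws.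

(* Main.v *)
Require Import Defs.
From HB Require Import structures.
From mathcomp Require Import all_boot all_order all_algebra.
From mathcomp Require Import all_classical all_reals all_analysis.
From mathcomp Require Import zify ring lra complex.
Set Implicit Arguments.
Unset Strict Implicit.
Unset Printing Implicit Defensive.

Import Order.TTheory GRing.Theory Num.Theory.
Import numFieldNormedType.Exports.
Local Open Scope ring_scope.

(** For c <= 2 sqrt(d - 1), take c + d vertices, with c of them independent and
    joined once to each of the d others, and with adjacency matrix J - A' on
    the others, where A' is c-regular.  An eigenvector other than the constant
    one has sum 0, so its restriction w to the d vertices satisfies
    w A' = - lambda w; hence |lambda| <= c and the multigraph is Ramanujan.  It
    attains the Hoffman bound: the independent set has density c / (c + d),
    about 2 / sqrt d.  Respectful noise keeps the lift of the independent set
    independent, so a certificate below c / (c + d) would tell the uniform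
    regular graph from the noisy lift.  Comparing the certified fraction with
    c / (c + d) takes a finite automaton only, since the digits come least
    significant first. *)

(** * Running a finite automaton on the output of a Turing machine *)

Lemma tm_run_more (T : turing_machine) (n m : nat) (c : tm_state T * tape) t :
  (n <= m)%N -> tm_run n c = Some t -> tm_run m c = Some t.
Proof.
elim: n m c => [|n IH] [|m] c //=; case: (tm_step c) => // c'.
by move=> le_nm; apply: IH.
Qed.

Lemma tm_run_size (T : turing_machine) (n : nat) (c : tm_state T * tape) t :
  tm_run n c = Some t -> (size (tright t) <= size (tright c.2) + n)%N.
Proof.
elim: n c => [|n IH] c /=.
  by case: (tm_step c) => // -[<-]; rewrite addn0.
case Ec: (tm_step c) => [c'|]; last by move=> [<-]; rewrite leq_addr.
move=> /IH /leq_trans; apply.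
suff: (size (tright c'.2) <= (size (tright c.2)).+1)%N by lia.
move: Ec; rewrite /tm_step.
case: (tm_trans _ _) => // -[[q b] a] [<-] /=.
by case: a => //=; rewrite size_behead; lia.
Qed.

Section FiniteAutomaton.
Variables (T : turing_machine) (Q : finType) (q0 : Q).
Variables (delta : Q -> bool -> Q) (acc : pred Q).

(* [inr (inr false)] blanks the cell to the right of the answer bit;
   [inr (inr true)] halts on the answer bit. *)
Definition automaton_trans (q : tm_state T + (Q + bool)) (h : option bool) :
    option ((tm_state T + (Q + bool)) * option bool * direction) :=
  match q with
  | inl q => if tm_trans q h is Some (q', b, a) then Some (inl q', b, a)
             else Some (inr (inl q0), h, Stay)
  | inr (inl q) =>
      if h is Some b then Some (inr (inl (delta q b)), h, MoveRight)
      else Some (inr (inr false), Some (acc q), MoveRight)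
  | inr (inr false) => Some (inr (inr true), None, MoveLeft)
  | inr (inr true) => None
  end.

Definition tm_automaton : turing_machine :=
  TuringMachine (inl (tm_start T)) automaton_trans.

(** One step per letter, one to write the answer over the blank, and one to blank the next cell,
    where old symbols may remain. *)
Lemma tm_automaton_read (q : Q) (t : tape) :
  omap tape_output (tm_run (size (tape_output t)).+2
     ((inr (inl q), t) : tm_state tm_automaton * tape))
  = Some [:: acc (foldl delta q (tape_output t))].
Proof.
case: t => l h r; rewrite /tape_output /=.
by elim: r l h q => [|h' r IH] l [b|] q /=.
Qed.

Lemma tm_automaton_simul (n m : nat) (q : tm_state T) (t t' : tape) r :
  tm_run n (q, t) = Some t' ->
  tm_run m ((inr (inl q0), t') : tm_state tm_automaton * tape) = Some r ->
  tm_run (n + m).+1 ((inl q, t) : tm_state tm_automaton * tape) = Some r.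
Proof.
move=> run1 run2; elim: n q t run1 => [|n IH] q t /=; rewrite /tm_step /=.
  case: tm_trans => [[[q' b] a]|] // [->].
  by rewrite add0n; move: run2; case: t'.
case E: tm_trans => [[[q' b] a]|] //; first exact: IH.
move=> [Et]; have : (m <= (n.+1 + m))%N by lia.
by move=> /tm_run_more /(_ run2); rewrite -Et; case: (t).
Qed.

End FiniteAutomaton.

Lemma polytime_automaton (f : seq bool -> seq bool) (Q : finType) (q0 : Q)
    (delta : Q -> bool -> Q) (acc : pred Q) :
  polytime f -> polytime (fun w => [:: acc (foldl delta q0 (f w))]).
Proof.
move=> [T [p Hp]]; exists (tm_automaton T q0 delta acc).
(* [p] steps for the machine; [size w + p + 1] bounds its output, as the tape grows by at most one
   cell per step; one step for the switch and two for the answer. *)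
exists (p + p + 'X + 4%:P) => w.
have := Hp w; case run1: (tm_run _ _) => [t|] //= [ft].
have := tm_automaton_read T q0 delta acc q0 t.
case run2: (tm_run _ _) => [r|] //= [out]; rewrite -ft.
have run12 := tm_automaton_simul run1 run2.
rewrite (tm_run_more _ run12) /= ?out //.
rewrite !hornerD hornerX hornerC /=.
have leL s : (size (leading_word s) <= size s)%N.
  by elim: s => [|[b|] s IH].
have := tm_run_size run1; rewrite /= size_behead size_map.
have : (size (tape_output t) <= (size (tright t)).+1)%N := leL (_ :: _).
move: (size (tape_output t)) (size (tright t)) => x y.
rewrite -[X in (_ < X)%N]/(p.[size w] + p.[size w] + size w + 4)%N.
by move: p.[size w] => P; lia.
Qed.

(** * Comparing fractions digit by digit *)

Section Comparison.
Variables a b : nat.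

(* With [s := u - a], this is s |-> floor ((s + b p - a q) / 2), which keeps
   track of the sign of b P - a Q for the numbers P and Q read so far. *)
Definition carry_step (u : nat) (p q : bool) : nat :=
  ((u + b * p + (if q then 0 else a))./2)%N.

(** The option keeps a digit of the first number until its partner is read; the ordinal is the
    shifted carry [u], so [a] stands for s = 0. *)
Definition compare_state : finType := (option bool * 'I_(a + b).+1)%type.

Definition compare_start : compare_state := (None, inord a).

Definition compare_step (s : compare_state) (x : bool) : compare_state :=
  if s.1 is Some p then (None, inord (carry_step s.2 p x)) else (Some x, s.2).

Definition compare_accept (s : compare_state) : bool := (a <= s.2)%N.

Lemma carry_step_le (u : nat) (p q : bool) :
  (u <= a + b -> carry_step u p q <= a + b)%N.
Proof. by rewrite /carry_step; case: p; case: q; lia. Qed.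

(** The integer s + b (p + 2P) - a (q + 2Q) is nonnegative exactly when floor((s + b p - a q) / 2) +
    b P - a Q is, so the carry may be halved after each pair of digits. Both sides ignore an
    unpaired last digit. *)
Lemma compare_foldl (u : 'I_(a + b).+1) (w : seq bool) :
  compare_accept (foldl compare_step (None, u) w) =
  (a + a * (nat_pair_of_word w).2 <= u + b * (nat_pair_of_word w).1)%N.
Proof.
have [n] := ubnP (size w); elim: n w u => // n IH [|p [|q w]] u Hn.
- by rewrite /= !muln0 !addn0.
- by rewrite /= !muln0 !addn0.
rewrite /= {2}/compare_step /= IH; last by move: Hn => /=; lia.
rewrite inordK; last by rewrite ltnS carry_step_le // -ltnS.
case: nat_pair_of_word => P Q /=; rewrite /carry_step !mulnDr -!muln2 !mulnA.
move: (b * P)%N (a * Q)%N => x y.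
by case: p q {Hn IH} => -[]; rewrite ?muln1 ?muln0; lia.
Qed.

Lemma compare_word (w : seq bool) :
  compare_accept (foldl compare_step compare_start w) =
  (a * (nat_pair_of_word w).2 <= b * (nat_pair_of_word w).1)%N.
Proof. by rewrite compare_foldl inordK ?leq_add2l // ltnS leq_addr. Qed.

End Comparison.

Lemma polytime_compare (f : seq bool -> seq bool) (a b : nat) :
  polytime f ->
  polytime (fun w => [:: (a * (nat_pair_of_word (f w)).2
                          <= b * (nat_pair_of_word (f w)).1)%N]).
Proof.
move=> /(polytime_automaton (compare_start a b) (@compare_step a b)
  (@compare_accept a b)).
by under eq_fun do rewrite compare_word.
Qed.

(** * Spectrum of a regular symmetric matrix *)

(* The quotient of [A] by the line of constant column vectors. *)
Definition deflation (F : comNzRingType) (n : nat) (A : 'M[F]_n.+1) : 'M[F]_n :=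
  \matrix_(i, j) (A (lift ord0 i) (lift ord0 j) - A ord0 (lift ord0 j)).

(** The all-ones vector is an eigenvector, as the rows sum to [d]. The base change [P] makes it the
    first basis vector and turns X - A into the block triangular [D]. *)
Lemma char_poly_deflation (F : comNzRingType) (n : nat) (A : 'M[F]_n.+1) (d : F) :
  (forall i, \sum_j A i j = d) ->
  char_poly A = ('X - d%:P) * char_poly (deflation A).
Proof.
move=> rowA.
pose P : 'M[{poly F}]_(1 + n) := block_mx 1%:M 0 (const_mx 1) 1%:M.
pose r : 'M[{poly F}]_(1, n) := \row_j (- (A ord0 (lift ord0 j))%:P).
pose D := block_mx ('X - d%:P)%:M r 0 (char_poly_mx (deflation A)).
have dP : \det P = 1 by rewrite det_lblock !det1 mulr1.
pose B : 'M[{poly F}]_(1 + n) := char_poly_mx A.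
have rowB i : \sum_j B i j = 'X - d%:P.
  rewrite -(rowA i) rmorph_sum /= -sumrN.
  under eq_bigr do rewrite !mxE; rewrite big_split /=; congr (_ + _).
  by rewrite (bigD1 i) //= eqxx big1 ?addr0 // => j /negbTE; rewrite eq_sym => ->.
have BP : B *m P = P *m D.
  rewrite -[B]submxK !mulmx_block !(mul1mx, mul0mx, mulmx0, mulmx1, addr0, add0r).
  congr block_mx; apply/matrixP => i j; rewrite !mxE ?ord1.
  - rewrite eqxx mulr1n -(rowB (lshift n 0)) big_split_ord big_ord1 !mxE.
    by congr (_ + _); apply: eq_bigr => l _; rewrite !mxE mulr1.
  - by rewrite rshift1 lshift0 (negbTE (neq_lift _ _)) mulr0n sub0r.
  - rewrite big_ord1 !mxE eqxx mul1r mulr1n.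
    rewrite -(rowB (rshift 1 i)) big_split_ord big_ord1 !mxE.
    by congr (_ + _); apply: eq_bigr => l _; rewrite !mxE mulr1.
  - rewrite big_ord1 !mxE mul1r !rshift1 (inj_eq (@lift_inj _ ord0)) rmorphB /=.
    by rewrite opprB addrCA addKr.
have : \det (B *m P) = \det (P *m D) by rewrite BP.
by rewrite !det_mulmx dP mulr1 mul1r det_ublock det_scalar1.
Qed.

Section Symmetric.
Variable R : realType.
Local Notation C := (R[i]).

(** Left eigenvectors of a quotient are row vectors that vanish on the subspace, here those of sum
    0; this dictates the coordinate at [ord0]. *)
Lemma deflation_eigenvector (n : nat) (A : 'M[C]_n.+1) (d z : C) :
  (forall i, \sum_j A i j = d) -> root (char_poly (deflation A)) z ->
  exists v : 'I_n.+1 -> C, [/\ exists i, v i != 0, \sum_i v i = 0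
    & forall j, \sum_i v i * A i j = z * v j].
Proof.
move=> rowA; rewrite -eigenvalue_root_char => /eigenvalueP [u uA u0].
pose v i := oapp (u ord0) (- \sum_j u ord0 j) (unlift ord0 i).
have v0 : v ord0 = - \sum_j u ord0 j by rewrite /v unlift_none.
have vS j : v (lift ord0 j) = u ord0 j by rewrite /v liftK.
have sv : \sum_i v i = 0.
  by rewrite big_ord_recl v0; under [X in _ + X]eq_bigr do rewrite vS; rewrite addNr.
have vAS j : \sum_i v i * A i (lift ord0 j) = z * v (lift ord0 j).
  have /matrixP/(_ ord0 j) := uA; rewrite !mxE vS => <-.
  rewrite big_ord_recl v0 mulNr mulr_suml -sumrN -big_split /=.
  by apply: eq_bigr => i _; rewrite vS mxE; ring.
exists v; split=> //.
  have [j uj] : exists j, u ord0 j != 0.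
    apply/existsP; rewrite -negb_forall; apply: contraNN u0 => /forallP u0.
    by apply/eqP/rowP => j; rewrite mxE; apply/eqP.
  by exists (lift ord0 j); rewrite vS.
move=> j; have [->|[j' ->]] : j = ord0 \/ exists j', j = lift ord0 j'.
  by case: (unliftP ord0 j) => [j' ->|->]; [right; exists j'|left].
  (* The row [v A] has sum 0 as well, so the equation at [ord0] follows from the others. *)
  have : \sum_j \sum_i v i * A i j = 0.
    rewrite exchange_big /=.
    under eq_bigr do rewrite -mulr_sumr rowA.
    by rewrite -mulr_suml sv mul0r.
  rewrite big_ord_recl; under [X in _ + X]eq_bigr do rewrite vAS.
  move/eqP; rewrite addr_eq0 => /eqP ->.
  by move/eqP: sv; rewrite big_ord_recl addr_eq0 -mulr_sumr => /eqP ->; rewrite mulrN.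
by rewrite vAS.
Qed.

Lemma symmetric_eigenvalue_real (n : nat) (A : 'M[R]_n) (v : 'I_n -> C) (z : C) :
  A^T = A -> (exists i, v i != 0) ->
  (forall j, \sum_i v i * (A i j)%:C%C = z * v j) -> z \is Num.real.
Proof.
move=> symA [i0 vi0] vA.
pose N := \sum_j v j * (v j)^*%C.
have N0 : N != 0.
  rewrite gt_eqF // /N (bigD1 i0) //=.
  apply: ltr_pwDl; last by apply: sumr_ge0 => i _; exact: mulcJ_ge0.
  by rewrite lt_def mulcJ_ge0 andbT mulf_neq0 // conjc_eq0.
have E : z * N = z^*%C * N.
  transitivity (\sum_j (\sum_i v i * (A i j)%:C%C) * (v j)^*%C).
    by rewrite mulr_sumr; apply: eq_bigr => j _; rewrite vA mulrA.
  transitivity (\sum_i v i * (\sum_j v j * (A j i)%:C%C)^*%C).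
    under eq_bigr do rewrite mulr_suml.
    rewrite exchange_big; apply: eq_bigr => i _.
    rewrite rmorph_sum mulr_sumr; apply: eq_bigr => j _.
    rewrite rmorphM [X in _ * (_ * X)](conjc_real (A j i)) -[in RHS]symA mxE; ring.
  by rewrite mulr_sumr; apply: eq_bigr => j _; rewrite vA rmorphM /=; ring.
move/(mulIf N0): E; case: z {vA} => a b [] /eqP.
by rewrite -subr_eq0 opprK complex_real -mulr2n mulrn_eq0.
Qed.

(** The deflation need not be symmetric, so its eigenvalues are taken in [C]; each belongs to an
    eigenvector of [A] of sum 0, which makes it real and at most [b] in modulus. *)
Lemma regular_spectrum (k d : nat) (M : 'M[nat]_k) (b : R) :
  (1 < k)%N -> regular_multigraph d M -> b <= d%:R ->
  (forall (v : 'I_k -> C) (z : C), (exists i, v i != 0) -> \sum_i v i = 0 ->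
     (forall j, \sum_i v i * (M i j)%:R = z * v j) -> `|z| <= b%:C%C) ->
  exists2 s : seq R, ordered_spectrum M s & Num.max `|s`_1| `|s`_k.-1| <= b.
Proof.
case: k M => [|[|n]] M // _ [symM rowM] le_bd bound.
pose A : 'M[R]_n.+2 := map_mx (fun a : nat => a%:R) M.
pose AC := map_mx (real_complex R) A.
have symA : A^T = A by apply/matrixP => i j; rewrite !mxE -[in RHS]symM mxE.
have rowA i : \sum_j A i j = d%:R.
  by rewrite -(rowM i) natr_sum; apply: eq_bigr => j _; rewrite mxE.
have rowAC i : \sum_j AC i j = d%:R%:C%C.
  by rewrite -(rowA i) rmorph_sum; apply: eq_bigr => j _; rewrite mxE.
have [rs Ers] := closed_field_poly_normal (char_poly (deflation AC)).
have := char_poly_monic (deflation AC); rewrite monicE => /eqP lc1.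
rewrite lc1 scale1r in Ers.
have rsP z : z \in rs -> z \is Num.real /\ `|z| <= b%:C%C.
  move=> zrs; have : root (char_poly (deflation AC)) z.
    by rewrite Ers root_prod_XsubC.
  move=> /(deflation_eigenvector rowAC) [v [v0 sv vA]]; split.
    apply: (symmetric_eigenvalue_real symA v0) => j.
    by rewrite -vA; apply: eq_bigr => i _; rewrite [AC i j]mxE.
  apply: bound v0 sv _ => j; rewrite -vA; apply: eq_bigr => i _.
  by rewrite !mxE rmorph_nat.
pose t := sort (fun x y : R => y <= x) (map (@complex.Re R) rs).
have tP x : x \in t -> `|x| <= b.
  rewrite mem_sort => /mapP [z /rsP [zr zb] ->].
  rewrite -lecR; apply: le_trans zb; exact: normc_ge_Re.
have size_t : size t = n.+1.
  rewrite size_sort size_map; apply/eqP;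
  rewrite -eqSS -(size_prod_XsubC rs id) -Ers.
  by rewrite size_char_poly.
have Edef : map_poly (real_complex R) (char_poly A) =
    ('X - d%:R%:C%C%:P) * \prod_(z <- rs) ('X - z%:P).
  by rewrite map_char_poly (char_poly_deflation rowAC) Ers.
(* As b <= d, the eigenvalue [d] may stand first; since k > 1, the indices 1 and k - 1 both point
   into [t]. *)
exists (d%:R :: t).
  split.
    rewrite /= path_min_sorted; last first.
      by apply/allP => x /tP; rewrite ler_norml => /andP[_ /le_trans]; apply.
    by apply: sort_sorted => x y; exact: le_total.
  apply: (map_poly_inj (real_complex R)); rewrite Edef big_cons.
  rewrite [RHS]rmorphM; congr (_ * _); first by rewrite [RHS]map_polyXsubC.
  rewrite (perm_big (map (@complex.Re R) rs)) ?perm_sort //= big_map.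
  rewrite [RHS]rmorph_prod.
  rewrite big_seq [RHS]big_seq; apply: eq_bigr => z /rsP [zr _].
  by rewrite [RHS]map_polyXsubC; congr ('X - _%:P); exact: esym (RRe_real zr).
by rewrite ge_max; apply/andP; split; apply: tP; rewrite /= mem_nth ?size_t.
Qed.

End Symmetric.

(** * The base multigraph and its eigenvalues *)

(* The second diagonal block is J - A', where A' is a c-regular symmetric
   0/1 matrix; any such A' would do. *)
Definition hoffman_multigraph (c d : nat) : 'M[nat]_(c + d) :=
  block_mx (const_mx 0%N) (const_mx 1%N) (const_mx 1%N)
    (\matrix_(i < d, j < d) (~~ ((i + j) %% d < c)%N : nat)).

(** Translation by [i] permutes the residues modulo [d], and [c] of them lie below [c]. Hence A' is
    c-regular. *)
Lemma sum_antidiagonals (c d i : nat) :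
  (c <= d)%N -> (\sum_(j < d) ((i + j) %% d < c) = c)%N.
Proof.
case: d => [|d] le_cd; first by rewrite big_ord0; case: c le_cd.
transitivity (\sum_(j < d.+1) (j < c))%N.
  rewrite [RHS](reindex_inj (addrI (inZp i : 'I_d.+1))) /=.
  by apply: eq_bigr => j _; rewrite modnDml.
rewrite -big_mkcond /= -(big_ord_widen _ (fun=> 1%N) le_cd).
by rewrite sum1_card card_ord.
Qed.

Lemma hoffman_multigraph_regular (c d : nat) :
  (c <= d)%N -> regular_multigraph d (hoffman_multigraph c d).
Proof.
move=> le_cd; split.
  rewrite tr_block_mx !trmx_const; congr block_mx.
  by apply/matrixP => i j; rewrite !mxE addnC.
move=> i; case: (split_ordP i) => {}i ->; rewrite big_split_ord /=.
  under eq_bigr do rewrite block_mxEul mxE.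
  under [X in (_ + X)%N]eq_bigr do rewrite block_mxEur mxE.
  by rewrite big1 // sum_nat_const card_ord muln1.
under eq_bigr do rewrite block_mxEdl mxE.
under [X in (_ + X)%N]eq_bigr do rewrite block_mxEdr mxE.
rewrite sum_nat_const card_ord muln1 -{1}(sum_antidiagonals i le_cd) -big_split.
rewrite -[RHS]card_ord -sum1_card.
by apply: eq_bigr => j _ /=; case: (_ < c)%N.
Qed.

Lemma hoffman_multigraph_eigenvalue (R : realType) (c d : nat)
    (v : 'I_(c + d) -> R[i]) (z : R[i]) :
  (c <= d)%N -> (exists i, v i != 0) -> \sum_i v i = 0 ->
  (forall j, \sum_i v i * (hoffman_multigraph c d i j)%:R = z * v j) ->
  `|z| <= c%:R.
Proof.
move=> le_cd [i0 vi0] sv vM.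
pose S := \sum_(j < d) `|v (rshift c j)|.
have S0 : 0 <= S by apply: sumr_ge0.
have zv j : z * v (rshift c j) =
    - \sum_(i < d) v (rshift c i) * ((i + j) %% d < c)%N%:R.
  apply/eqP; rewrite -addr_eq0 -vM; apply/eqP.
  rewrite -[RHS]sv !big_split_ord /= -addrA -big_split /=; congr (_ + _);
    apply: eq_bigr => i _.
    by rewrite block_mxEur mxE mulr1.
  by rewrite block_mxEdr mxE -mulrDr; case: (_ < c)%N; rewrite ?add0r ?addr0 mulr1.
(* An l^1 estimate: A' is nonnegative with row sums [c]. *)
have zS : `|z| * S <= c%:R * S.
  rewrite /S mulr_sumr.
  apply: (@le_trans _ _ (\sum_(j < d) \sum_(i < d)
      `|v (rshift c i)| * ((i + j) %% d < c)%N%:R)).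
    apply: ler_sum => j _; rewrite -normrM zv normrN.
    apply: le_trans (ler_norm_sum _ _ _) _.
    by apply: ler_sum => i _; rewrite normrM normr_nat.
  rewrite exchange_big mulr_sumr; apply: ler_sum => i _.
  by rewrite -mulr_sumr -natr_sum sum_antidiagonals // mulrC.
have [Sz|Sn0] := eqVneq S 0; last first.
  by rewrite -(ler_pM2r (x := S)) // lt_def Sn0.
(* If w = 0, then v lives on the independent set, where v M vanishes, so z = 0. *)
have vT j : v (rshift c j) = 0.
  apply/eqP; rewrite -normr_eq0; apply/eqP.
  by move/eqP: Sz; rewrite psumr_eq0 // => /allP /(_ j (mem_index_enum _)) /eqP.
suff -> : z = 0 by rewrite normr0 ler0n.
move: vi0; case: (split_ordP i0) => i ->; last by rewrite vT eqxx.
move=> vi; apply/(mulIf vi); rewrite mul0r -vM big_split_ord /=.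
rewrite !big1 ?addr0 // => j _; first by rewrite vT mul0r.
by rewrite block_mxEul mxE mulr0.
Qed.

Lemma hoffman_multigraph_ramanujan (R : realType) (c d : nat) :
  (0 < c <= d)%N -> c%:R <= 2 * Num.sqrt (d%:R - 1) :> R ->
  ramanujan R d (hoffman_multigraph c d).
Proof.
move=> /andP[c0 le_cd] le_c.
have [||||s spec bound] := @regular_spectrum R (c + d) d
    (hoffman_multigraph c d) c%:R.
- by lia.
- exact: hoffman_multigraph_regular.
- by rewrite ler_nat.
- by move=> v z v0 sv vM; rewrite rmorph_nat (hoffman_multigraph_eigenvalue le_cd v0).
by exists s => //; exact: le_trans bound le_c.
Qed.

(** * Independent sets in noisy lifts *)

Lemma lift_graph_edge (k m : nat) (M : 'M[nat]_k) (s : lift_sample k M m) e :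
  s \in lift_space M m -> e \in lift_graph s ->
  exists x y, [/\ x \in e, y \in e & M (s.1 x) (s.1 y) != 0%N].
Proof.
rewrite inE => /and3P[_ /forallP matching _] /bigcupP[f _ ef].
have /andP[/forall_inP/(_ e ef)/existsP[x /existsP[y xy]] _] := matching f.
case/and4P: xy => /eqP-> _ /eqP sx /eqP sy.
exists x, y; rewrite set21 set22 sx sy; split=> //.
(* The edge [f] contains an element of ['I_(M i j)], which is empty when [M i j] is 0. *)
by rewrite /edge_fst /edge_snd; case: (val f) => -[i j] /= [[]]; case: (M i j).
Qed.

Lemma fiber_union_card (k m : nat) (M : 'M[nat]_k) (s : lift_sample k M m)
    (I : {set 'I_k}) :
  s \in lift_space M m -> #|[set v | s.1 v \in I]| = (#|I| * m)%N.
Proof.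
rewrite inE => /and3P[/forallP fibers _ _].
rewrite -sum1_card (partition_big s.1 (mem I)) /=; last by move=> v; rewrite inE.
rewrite -sum_nat_const; apply: eq_bigr => i iI.
rewrite -[RHS](eqP (fibers i)) -sum1_card; apply: eq_bigl => v; rewrite !inE.
by case: eqP => [->|]; rewrite ?iI ?andbF.
Qed.

(** The union of the fibers over [I] is independent in [E']: lift edges and, by respectfulness,
    added edges only join fibers of adjacent base vertices. *)
Lemma noisy_lift_alpha_hat (R : realType) (k d m : nat) (M : 'M[nat]_k)
    (I : {set 'I_k}) (s : lift_sample k M m) (E' : edge_set (k * m)) :
  (forall i j, i \in I -> j \in I -> M i j = 0%N) -> (0 < m)%N ->
  s \in lift_space M m -> regular_graph d E' ->
  (forall e, e \in E' :\: lift_graph s -> respects M s.1 e) ->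
  #|I|%:R / k%:R <= alpha_hat R E'.
Proof.
move=> indI m0 sM /andP[/forall_inP card2 _] resp.
have indS : independent E' [set v | s.1 v \in I].
  apply/forall_inP => e eE'; apply/negP => /fintype.subsetP eI.
  have [x [y [xe ye /eqP]]] :
      exists x y, [/\ x \in e, y \in e & M (s.1 x) (s.1 y) != 0%N].
    have [eL|eN] := boolP (e \in lift_graph s); first exact: lift_graph_edge eL.
    have /cards2P [x [y [xy defe]]] := card2 e eE'.
    have := resp e; rewrite inE eN eE' => /(_ isT) /forall_inP /(_ x).
    rewrite defe set21 => /(_ isT) /forall_inP /(_ y).
    by rewrite set22 xy => /(_ isT) /= Mxy; exists x, y; rewrite set21 set22.
  by apply; apply: indI; [have := eI x xe|have := eI y ye]; rewrite inE.
have /= := leq_bigmax_cond (F := fun S : {set 'I_(k * m)} => #|S|) _ indS.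
rewrite (fiber_union_card I sM) -/(independence_number E') => le_alpha.
have [k0|k0] := posnP k.
  by rewrite (_ : k%:R = 0 :> R) ?k0 // invr0 mulr0 divr_ge0.
rewrite /alpha_hat ler_pdivlMr ?ltr0n ?muln_gt0 ?k0 // natrM mulrA.
by rewrite mulfVK ?pnatr_eq0 -?lt0n // -natrM ler_nat.
Qed.

(** A singleton is independent. Positivity will exclude certified fractions with denominator 0,
    which have value 0 but pass the detection test. *)
Lemma alpha_hat_gt0 (R : realType) (n d : nat) (E : edge_set n) :
  (0 < n)%N -> regular_graph d E -> 0 < alpha_hat R E.
Proof.
move=> n0 /andP[/forall_inP card2 _]; rewrite divr_gt0 ?ltr0n //.
have ind1 : independent E [set Ordinal n0].
  apply/forall_inP => e /card2 /eqP e2; apply/negP => /subset_leq_card.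
  by rewrite e2 cards1.
have := leq_bigmax_cond (F := fun S : {set 'I_n} => #|S|) _ ind1.
by rewrite cards1.
Qed.

(** * From a certificate to a detection test *)

Lemma prob_uniform_law_complement (R : realType) (T : finType) (S : {set T})
    (A B : pred T) :
  (forall x, x \in S -> A x -> ~~ B x) ->
  0 <= prob (uniform_law R S) A <= 1 - prob (uniform_law R S) B.
Proof.
move=> AB.
have u0 x : 0 <= uniform_law R S x by rewrite divr_ge0.
(* Only an inequality, because the mass is 0 when [S] is empty. *)
have total : \sum_x uniform_law R S x <= 1.
  rewrite -mulr_suml -natr_sum -(big_mkcond (mem S) (fun=> 1%N)) sum1_card.
  have [->|S0] := eqVneq #|S| 0%N; first by rewrite mul0r.
  by rewrite divff // pnatr_eq0.
apply/andP; split; first exact: sumr_ge0.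
rewrite lerBrDr; apply: le_trans total.
rewrite /prob [leRHS](bigID B) /= addrC lerD2r.
rewrite big_mkcond [leRHS]big_mkcond; apply: ler_sum => x _.
have [Ax|//] := boolP (A x); last by case: ifP.
have [xS|xS] := boolP (x \in S); first by rewrite (AB x xS Ax).
by rewrite /uniform_law (negbTE xS) mul0r if_same.
Qed.

(** Handshake: without loops, the entries of the symmetric [M] pair off across the diagonal. *)
Lemma regular_multigraph_even (k d : nat) (M : 'M[nat]_k) :
  regular_multigraph d M -> ~~ has_loop M -> ~~ odd (k * d).
Proof.
move=> [symM rowM] /existsPn noloop.
have -> : (k * d = \sum_i \sum_j M i j)%N.
  under eq_bigr do rewrite rowM.
  by rewrite sum_nat_const card_ord.
rewrite (pair_bigA _ (fun i j => M i j)) /=.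
rewrite (bigID (fun p : 'I_k * 'I_k => p.1 < p.2)%N) /=.
rewrite [X in (_ + X)%N](bigID (fun p : 'I_k * 'I_k => p.2 < p.1)%N) /=.
rewrite [X in (_ + (_ + X))%N]big1 => [|[i j] /= /andP[ij ji]]; last first.
  have /eqP <- : i == j by rewrite -val_eqE /=; lia.
  by apply/eqP; have := noloop i; rewrite negbK.
rewrite addn0 [X in (_ + X)%N]
  (_ : _ = \sum_(p : 'I_k * 'I_k | (p.1 < p.2)%N) M p.1 p.2).
  by rewrite addnn odd_double.
rewrite (reindex_inj (h := fun p : 'I_k * 'I_k => (p.2, p.1))) /=; last first.
  by move=> [? ?] [? ?] /= [-> ->].
apply: eq_big => [[i j]|[i j] _] /=; first by lia.
by rewrite -[in RHS]symM mxE.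
Qed.

(** With loops m is even, without them k d is; so k m d is even and limits over regular graphs apply
    along the sizes of lifts. *)
Lemma lift_sizes_regular_sizes (k d : nat) (M : 'M[nat]_k) :
  (0 < k)%N -> regular_multigraph d M ->
  ((fun m => (k * m)%N) @ lift_sizes M --> regular_sizes d)%classic.
Proof.
move=> k0 regM A [N _ HN]; exists N => // m /= Nm loop.
apply: HN => /=; first exact: (leq_trans Nm (leq_pmull _ k0)).
rewrite mulnAC oddM negb_and.
have [hl|nl] := boolP (has_loop M); first by rewrite (implyP loop hl) orbT.
by rewrite (regular_multigraph_even regM nl).
Qed.

Lemma ler_nat_fractions (R : realFieldType) (a b p q : nat) :
  (0 < b)%N -> (0 < q)%N ->
  (a%:R / b%:R <= p%:R / q%:R :> R) = (a * q <= b * p)%N.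
Proof.
move=> b0 q0; rewrite ler_pdivrMr ?ltr0n // mulrAC ler_pdivlMr ?ltr0n //.
by rewrite -!natrM ler_nat [(b * p)%N]mulnC.
Qed.

Lemma no_certificate_of_ramanujan (R : realType) (k d : nat) (M : 'M[nat]_k)
    (I : {set 'I_k}) (B : R) (c : seq bool -> seq bool) :
  conjecture_L R -> (0 < k)%N -> (3 <= d)%N -> regular_multigraph d M ->
  ramanujan R d M ->
  (forall i j, i \in I -> j \in I -> M i j = 0%N) ->
  B < #|I|%:R / k%:R -> polytime c -> ~ certifies_whp d (@alpha_hat R) B c.
Proof.
move=> conjL k0 d3 regM ramM indI ltB polyc [bound whp].
have half01 : 0 < (2^-1 : R) < 1 by apply/andP; split; lra.
have [/(_ ramM) [_ _ _ [K [advK respK] hardK]] _] :=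
  conjL d k M 2^-1 d3 regM half01.
apply: hardK.
(* The test guesses the lift when the certified p/q is at least |I|/k, with denominators cleared for
   the automaton. *)
exists (fun w => #|I| * (nat_pair_of_word (c w)).2
                 <= k * (nat_pair_of_word (c w)).1)%N.
split; first exact: polytime_compare.
have filterF : Filter (lift_sizes M) by exact: within_filter.
have m_gt0 : \forall m \near lift_sizes M, (0 < m)%N by exists 1%N.
split.
  (* For m > 0 the test never errs on noisy lifts, where the certified value is at least
     [alpha_hat], hence at least |I|/k. *)
  apply: cvg_near_cst; near=> m.
  apply: big1 => E' /negP ntest; apply: big1 => s _.
  rewrite /uniform_law; have [sM|_] := boolP (s \in lift_space M m); last first.
    by rewrite !mul0r.
  have [->|KE] := eqVneq (K m s.1 (lift_graph s) E') 0; first by rewrite mulr0.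
  case: ntest.
  have [_ _ /(_ E' KE) [regE' _]] := advK m s sM.
  have m0 : (0 < m)%N by near: m.
  have := noisy_lift_alpha_hat R indI m0 sM regE' (respK m s sM E' KE).
  move=> /le_trans /(_ (bound _ E' regE')); rewrite /certified_value.
  case: nat_pair_of_word => p q /=.
  have [->|q0] := posnP q; first by rewrite muln0.
  by rewrite ler_nat_fractions.
(* On uniform regular graphs, acceptance puts the certified value above [B], an event whose
   probability tends to 0. *)
apply: (@squeeze_cvgr _ _ _ _ (fun=> 0)
  (fun m => 1 - prob (@random_regular R (k * m) d)
                  (fun E => certified_value R c E <= B))).
- near=> m; apply: prob_uniform_law_complement => E; rewrite inE => regE test.
  have m0 : (0 < m)%N by near: m.
  rewrite -ltNge; apply: lt_le_trans ltB _.
  have := lt_le_trans (alpha_hat_gt0 R _ regE) (bound _ E regE).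
  rewrite muln_gt0 k0 m0 => /(_ isT); move: test; rewrite /certified_value.
  case: nat_pair_of_word => p q /=.
  have [->|q0] := posnP q; first by rewrite invr0 mulr0 ltxx.
  by rewrite ler_nat_fractions.
- exact: cvg_cst.
- rewrite -[X in (_ --> X)%classic](subrr (1 : R)).
  apply: cvgB; first exact: cvg_cst.
  exact: cvg_comp (lift_sizes_regular_sizes k0 regM) whp.
Unshelve. all: by end_near.
Qed.

(** * Asymptotics of the independent density *)

Lemma hoffman_ratio (R : realType) (eps : R) (o : nat -> R) :
  0 < eps -> (o d @[d --> \oo] --> (0 : R))%classic ->
  exists d0 : nat, forall d : nat, (d0 <= d)%N ->
  exists c : nat, [/\ (3 <= d)%N, (0 < c <= d)%N,
    c%:R <= 2 * Num.sqrt (d%:R - 1) :> R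
    & 2 / Num.sqrt d%:R * (1 - eps + o d) < c%:R / (c + d)%:R].
Proof.
move=> eps0 oo.
have [N _ HN] : \forall d \near \oo%classic, o d < eps / 2.
  by apply: (cvgr_lt 0) => //; rewrite divr_gt0.
(* With x = sqrt d, these bounds give o d < eps/2, x >= 2 and x > 6/eps, whence 1 - eps + o d < 1 -
   3/x. *)
exists (maxn N (maxn 4 (Num.truncn ((6 / eps) ^+ 2)).+1)) => d.
rewrite !geq_max => /and3P[/HN /= od d4 dtr].
set x : R := Num.sqrt d%:R.
have xx : x ^+ 2 = d%:R by rewrite sqr_sqrtr.
have x0 : 0 <= x by exact: sqrtr_ge0.
have x2 : 2 <= x.
  have : (4%:R : R) <= d%:R by rewrite ler_nat.
  by rewrite -xx leNgt => ?; apply/negP => ?; nra.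
have xe : 6 / eps < x.
  have : (6 / eps) ^+ 2 < d%:R :> R.
    by apply: lt_le_trans (truncnS_gt _) _; rewrite ler_nat.
  have : 0 < 6 / eps by rewrite divr_gt0.
  by rewrite -xx ltNge => ? ?; apply/negP => ?; nra.
(* The bound c <= 2x - 1 gives c <= 2 sqrt(d - 1), while c > 2x - 2 keeps the density above (2/x)(1
   - 3/x). *)
pose c := Num.truncn (2 * x - 1).
have [c1 c2] : c%:R <= 2 * x - 1 /\ 2 * x - 2 < c%:R.
  have := truncn_itv (x := 2 * x - 1); rewrite -/c -natr1 => /(_ _)/andP[|? ?].
    by lra.
  by split; lra.
exists c; split.
- exact: ltnW.
- apply/andP; split; first by rewrite -(ltr0n R); lra.
  by rewrite -(ler_nat R) -xx; nra.
- apply: le_trans c1 _.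
  have := sqrtr_ge0 (d%:R - 1 : R).
  have : Num.sqrt (d%:R - 1) ^+ 2 = x ^+ 2 - 1 :> R.
    by rewrite sqr_sqrtr -xx //; nra.
  by move: (Num.sqrt _) => y; rewrite leNgt => ? ?; apply/negP => ?; nra.
rewrite natrD -xx.
have x1 : 0 < x by lra.
have od' : 1 - eps + o d < 1 - 3 / x.
  have : 3 / x < eps / 2.
    by rewrite ltr_pdivrMr // mulrAC ltr_pdivlMr // -ltr_pdivrMl // mulrC; lra.
  by lra.
apply: (@lt_le_trans _ _ (2 / x * (1 - 3 / x))).
  by rewrite ltr_pM2l // divr_gt0.
rewrite ler_pdivlMr; last by nra.
rewrite (_ : 2 / x * (1 - 3 / x) = (2 * x - 6) / x ^+ 2); last by field; lra.
rewrite mulrAC ler_pdivrMr; last by nra.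
(* The goal is (2x - 6) x^2 <= c (x^2 - 2x + 6); replacing c by 2x - 2 leaves the surplus 16x -
   12. *)
have : 0 <= (c%:R - (2 * x - 2)) * (x ^+ 2 - 2 * x + 6) by apply: mulr_ge0; nra.
by nra.
Qed.

Theorem theorem1p14 (R : realType) :
  conjecture_L R ->
  forall eps : R, 0 < eps ->
  forall o : nat -> R, (o d @[d --> \oo] --> (0 : R))%classic ->
  exists d0 : nat, forall d : nat, (d0 <= d)%N ->
  ~ exists c : seq bool -> seq bool,
      polytime c /\
      certifies_whp d (@alpha_hat R) (2 / Num.sqrt d%:R * (1 - eps + o d)) c.
Proof.
move=> conjL eps eps0 o oo.
have [d0 Hd0] := hoffman_ratio eps0 oo; exists d0 => d /Hd0.
move=> [k [d3 /andP[k0 le_kd] le_k ratio]] [c [polyc]].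
pose I : {set 'I_(k + d)} := [set lshift d i | i in 'I_k].
have cardI : #|I| = k by rewrite card_imset ?card_ord //; exact: lshift_inj.
apply: (no_certificate_of_ramanujan (I := I) conjL _ d3
  (hoffman_multigraph_regular le_kd) _ _ _ polyc).
- by rewrite addn_gt0 k0.
- by apply: hoffman_multigraph_ramanujan; rewrite ?k0.
- by move=> _ _ /imsetP[i _ ->] /imsetP[j _ ->]; rewrite block_mxEul mxE.
- by rewrite cardI.
Qed.
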